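(* Let $(X,\mathcal{U})$ be a uniform space, equipped with its uniform topology. If $X$ is pseudocompact, then $X$ is a Baire space.
   Context: A uniform structure (uniformity) on a nonempty set $X$ is a filter $\mathcal{U}$ on $X\times X$, whose elements are called entourages, such that: every $U\in\mathcal{U}$ contains the diagonal $\Delta=\{(x,x):x\in X\}$; if $U\in\mathcal{U}$ then $U^{-1}=\{(y,x):(x,y)\in U\}\in\mathcal{U}$; and for each $U\in\mathcal{U}$ there is $V\in\mathcal{U}$ with $V\circ V\subset U$, where $V\circ V=\{(x,y):\exists z\in X,\ (x,z)\in V,\ (z,y)\in V\}$. A uniform space is not assumed to be separated (Hausdorff). For $U\in\mathcal{U}$ and $x\in X$ put $U[x]=\{y\in X:(x,y)\in U\}$. The uniform topology $\mathcal{T}_{\mathcal{U}}$ on $X$ is the one in which $A\subset X$ is open if and only if for each $x\in A$ there is $U\in\mathcal{U}$ with $U[x]\subset A$; topological properties of a uniform space refer to this topology. A topological space $X$ is pseudocompact if every continuous function $f:X\to\mathbb{R}$ has bounded image. A topological space is a Baire space if every countable intersection of dense open sets is dense. *)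

(* Defs.v *)
From HB Require Import structures.
From mathcomp Require Import all_boot all_order all_algebra.
From mathcomp Require Import all_classical all_reals all_analysis.

Set Implicit Arguments.
Unset Strict Implicit.
Unset Printing Implicit Defensive.

Import numFieldNormedType.Exports.
Local Open Scope classical_set_scope.

(* The real line is an arbitrary [R : realType] with its usual topology. *)
Definition pseudocompact (R : realType) (T : topologicalType) : Prop :=
  forall f : T -> R, continuous f -> bounded_set (range f).

Definition baire_space (T : topologicalType) : Prop :=
  forall F : set (set T), countable F ->
    (forall A, F A -> open A /\ dense A) -> dense (\bigcap_(A in F) A).

(* Main.v *)
Require Import Defs.
From HB Require Import structures.
From mathcomp Require Import all_boot all_order all_algebra.
From mathcomp Require Import all_classical all_reals all_analysis.

(** If a decreasing sequence of nonempty open sets [U n] had closures with empty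
    intersection, it would be locally finite.  By complete regularity there are
    bumps of height [n] supported in [U n], and their sum would be a continuous
    unbounded function.  Given dense open sets [G n] and a nonempty open set [O],
    regularity yields such a sequence inside [O] with
    [closure (U n.+1) `<=` U n `&` G n], so [O] meets all the [G n]. *)

Set Implicit Arguments.
Unset Strict Implicit.
Unset Printing Implicit Defensive.

Import Order.TTheory GRing.Theory Num.Theory numFieldNormedType.Exports.
Local Open Scope classical_set_scope.

Lemma bump_function (R : realType) (X : uniformType) (x : X) (V : set X) :
  open V -> V x -> exists f : X -> R,
    [/\ continuous f, forall y, (0 <= f y)%R, f x = 1%R
      & forall y, ~ V y -> f y = 0%R].
Proof.
move=> oV Vx.
have /(@uniform_separatorP _ R)[f [cf f01 fx fV]] :
    uniform_separator [set x] (~` V).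
  by apply: (@point_uniform_separator R) => //; rewrite closedC.
(* The separator [f] is 0 at [x] and 1 off [V], with values in [0, 1], so it is flipped. *)
exists (fun y => 1 - f y)%R; split.
- by move=> y; apply: cvgB; [exact: cvg_cst|exact: cf].
- move=> y; have : range f (f y) by exists y.
  by move=> /f01/=; rewrite in_itv/= subr_ge0 => /andP[].
- by rewrite (fx (f x)) ?subr0//; exists x.
- by move=> y nVy; rewrite (fV (f y)) ?subrr//; exists y.
Qed.

Lemma continuous_sum_ord (R : realType) (X : topologicalType)
    (f : nat -> X -> R) (n : nat) :
  (forall i, continuous (f i)) -> continuous (fun x => \sum_(i < n) f i x)%R.
Proof.
move=> cf x; elim: n => [|n IHn].
  by under eq_fun do rewrite big_ord0; exact: cvg_cst.
under eq_fun do rewrite big_ord_recr/=.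
by apply: cvgD; [exact: IHn|exact: cf].
Qed.

Lemma sum_ord_eventually0 (V : nmodType) (g : nat -> V) (m n : nat) :
  m <= n -> (forall i, m <= i -> g i = 0%R) ->
  (\sum_(i < n) g i = \sum_(i < m) g i)%R.
Proof.
move=> mn g0; rewrite -(subnKC mn) big_split_ord/= [X in (_ + X)%R]big1 ?addr0//.
by move=> i _; rewrite g0// leq_addr.
Qed.

Lemma pseudocompact_bigcap_closure (R : realType) (X : uniformType)
    (U : nat -> set X) :
  pseudocompact R X ->
  (forall n, open (U n)) -> (forall n, U n !=set0) ->
  (forall m n, m <= n -> U n `<=` U m) ->
  \bigcap_n closure (U n) !=set0.
Proof.
move=> pcX oU U0 Udecr; apply: contrapT => nU.
have /choice[N NP] : forall x, exists n, ~ closure (U n) x.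
  move=> x; apply/existsNP => clx.
  by apply: nU; exists x => n _.
have /choice[p pU] : forall n, exists x, U n x by move=> n; exact: U0.
have /choice[f fP] n := bump_function R (oU n) (pU n).
pose g i x := (i%:R * f i x)%R.
have gE n x i : ~ U n x -> n <= i -> g i x = 0%R.
  move=> nUx ni; rewrite /g; have [_ _ _ ->] := fP i; first by rewrite mulr0.
  by move=> /(Udecr _ _ ni).
(* This is the infinite sum of the [g i], cut off at a chosen index beyond which all terms vanish at
   [x]. By [FE] the value does not depend on that choice. *)
pose F x := (\sum_(i < N x) g i x)%R.
have FE n x : ~ U n x -> F x = (\sum_(i < n) g i x)%R.
  have nUN : ~ U (N x) x by move=> /subset_closure; exact: NP.
  move=> nUn; rewrite /F; have [Nn|/ltnW nN] := leqP (N x) n.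
    by rewrite [RHS](@sum_ord_eventually0 _ (g^~ x) (N x)) => // i; exact: gE.
  by rewrite (@sum_ord_eventually0 _ (g^~ x) n) => // i; exact: gE.
have cF : continuous F.
  move=> x.
  (* The cutoff [N x] remains valid on the whole complement of [closure (U (N x))], an open
     neighbourhood of [x], so [F] is a fixed finite sum there. *)
  have Fx : \forall y \near x, (\sum_(i < N x) g i y)%R = F y.
    have : nbhs x (~` closure (U (N x))).
      apply: open_nbhs_nbhs; split; last exact: NP.
      by rewrite openC; exact: closed_closure.
    apply: filterS => y ny; apply/esym/FE.
    by apply: contra_not ny; exact: subset_closure.
  apply: cvg_trans; first exact: near_eq_cvg Fx.
  rewrite /F; apply: continuous_sum_ord => i y; rewrite /g.
  by apply: cvgM; [exact: cvg_cst|have [cf _ _ _] := fP i; exact: cf].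
have [M [_ /(_ (M + 1)%R)]] := pcX F cF.
rewrite ltrDl => /(_ ltr01) FM.
(* Chosen so that [n] exceeds the bound [M + 1] of [F], whereas the [n]-th summand alone already
   equals [n] at [p n]. *)
pose n := (Num.truncn `|M + 1|%R).+1.
have : (n%:R <= `|F (p n)|)%R.
  (* The [n]-th summand survives the cutoff: otherwise [p n] would lie in [U (N (p n))]. *)
  have nN : n < N (p n).
    rewrite ltnNge; apply/negP => /Udecr/(_ _ (pU n)) /subset_closure.
    exact: NP.
  apply: (le_trans _ (ler_norm _)).
  rewrite /F (bigD1 (Ordinal nN))//= {1}/g.
  have [_ _ -> _] := fP n; rewrite mulr1 lerDl sumr_ge0// => i _.
  by rewrite mulr_ge0//; have [_ + _ _] := fP i; apply.
apply/negP; rewrite -ltNge; apply: (@le_lt_trans _ _ (M + 1)%R).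
  by apply: FM; exists (p n).
by apply: le_lt_trans (ler_norm _) _; rewrite truncnS_gt.
Qed.

Lemma dense_open_shrink (X : uniformType) (V G : set X) :
  open V -> V !=set0 -> open G -> dense G ->
  exists W : set X, [/\ open W, W !=set0 & closure W `<=` V `&` G].
Proof.
move=> oV V0 oG dG; have [x VGx] := dG V V0 oV.
have [W Wx clW] : exists2 W, nbhs x W & closure W `<=` V `&` G.
  apply: uniform_regular; apply: open_nbhs_nbhs; split => //.
  exact: openI.
(* Regularity gives a neighbourhood that need not be open, hence the interior. *)
exists (W°); split; [exact: open_interior|by exists x|].
by apply: subset_trans clW; apply: closureS; exact: interior_subset.
Qed.

Lemma pseudocompact_dense_bigcap (R : realType) (X : uniformType)
    (G : nat -> set X) :
  pseudocompact R X -> (forall n, open (G n)) -> (forall n, dense (G n)) ->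
  dense (\bigcap_n G n).
Proof.
move=> pcX oG dG O O0 oO.
(* Bundling openness and nonemptiness into a type makes the shrinking step a total function, which
   can then be iterated from [O]. *)
pose S := {V : set X | open V /\ V !=set0}.
have /choice[step stepP] : forall nV : nat * S, exists W : S,
    closure (sval W) `<=` sval nV.2 `&` G nV.1.
  move=> [n [V [oV V0]]]/=.
  have [W [oW W0 clW]] := dense_open_shrink oV V0 (oG n) (dG n).
  by exists (exist _ W (conj oW W0)).
pose U := fix U n : S :=
  if n is m.+1 then step (m, U m) else exist _ O (conj oO O0).
have clU n : closure (sval (U n.+1)) `<=` sval (U n) `&` G n.
  exact: (stepP (n, U n)).
have Udecr m n : m <= n -> sval (U n) `<=` sval (U m).
  elim: n => [|n IHn]; first by rewrite leqn0 => /eqP ->.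
  rewrite leq_eqVlt => /predU1P[->//|/IHn]; apply: subset_trans.
  by move=> x /subset_closure/clU[].
have [x xU] : \bigcap_n closure (sval (U n)) !=set0.
  apply: pseudocompact_bigcap_closure pcX _ _ Udecr => n.
    by case: (U n) => V [].
  by case: (U n) => V [].
(* Index 1 is needed here: [x] is only known to be in the closure of [O], but [closure (U 1)] lies
   inside [O]. *)
exists x; split; first by have [] := clU 0 x (xU 1%N Logic.I).
by move=> n _; have [] := clU n x (xU n.+1 Logic.I).
Qed.

Theorem mainTheorem2 (R : realType) (X : uniformType)
    (X_nonempty : [set: X] !=set0) :
  pseudocompact R X -> baire_space X.
Proof.
(* A countable family is either empty, with the whole space as intersection, or enumerated by a
   surjection [e] from the naturals, possibly with repetitions. *)
move=> pcX F /pfcard_geP[->|[e]] FP.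
  by rewrite bigcap_set0 => O O0 _; rewrite setIT.
have Fe n : F (e n) by exact: funS.
have -> : \bigcap_(A in F) A = \bigcap_n e n.
  apply/seteqP; split=> x FAx => [n _|A FA]; first exact: (FAx _ (Fe n)).
  by have [n _ <-] := 'surj_e FA; exact: FAx.
by apply: (@pseudocompact_dense_bigcap R) => // n; have [] := FP _ (Fe n).
Qed.
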